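(* Let $q$ be an odd prime power and $d$ an even positive integer. Then $$\left|s_2(q,d)-\frac{q^d}{d\,2^q}\right|<\frac{q}{2d}\,q^{d/2}.$$
   Context: A polynomial $f\in\mathbb{F}_q[t]$ is $2$-superirreducible if $f(g(t))$ is irreducible in $\mathbb{F}_q[t]$ for every $g\in\mathbb{F}_q[t]$ of degree $1$ or $2$. $s_2(q,d)$ denotes the number of monic $2$-superirreducible polynomials of degree $d$ in $\mathbb{F}_q[t]$. *)

(* Defs.v *)
From mathcomp Require Import all_boot all_order all_algebra.
From mathcomp Require Import boolp.

Set Implicit Arguments.
Unset Strict Implicit.
Unset Printing Implicit Defensive.

Import Order.TTheory GRing.Theory Num.Theory.
Local Open Scope ring_scope.

(* [size g] is the degree of [g] plus one, so [g] has degree 1 or 2;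
   [f \Po g] is f(g(t)). *)
Definition superirreducible2 (F : fieldType) (f : {poly F}) : Prop :=
  forall g : {poly F}, size g = 2%N \/ size g = 3%N ->
    irreducible_poly (f \Po g).

(* [{poly_(d.+1) F}] is the finite type of polynomials of degree at most d. *)
Definition s2 (F : finFieldType) (d : nat) : nat :=
  #|[set f : {poly_(d.+1) F} |
      [&& size (f : {poly F}) == d.+1, (f : {poly F}) \is monic
        & `[< superirreducible2 (f : {poly F}) >]]]|.

(* Main.v *)
Require Import Defs.
From mathcomp Require Import all_boot all_order all_algebra.
From mathcomp Require Import all_fingroup cyclic all_field.
From mathcomp Require Import boolp.
From mathcomp Require Import zify ring.

Set Implicit Arguments.
Unset Strict Implicit.
Unset Printing Implicit Defensive.

Import Order.TTheory GRing.Theory Num.Theory.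
Local Open Scope ring_scope.

(** Let L be the extension of F of degree d, and s = q^(d/2), so #|L| = s^2.
    Completing the square, and because d is even so that F consists of squares
    of L, an irreducible f of degree d with root x in L is 2-superirreducible
    iff x + c is a nonsquare for all c in F. Expanding the product over c of
    1 - chi(x + c), with chi the quadratic character of L, the number N of such
    x is 2^-q times a signed sum, over the subsets T of F, of the character sums
    of the products of the X + c with c in T. The empty T gives the main term
    q^d. The other sums are bounded by Weil's inequality, which for d >= 4
    follows from the Stepanov-Bombieri argument since s > (g + 1)^2 for the
    genus g of y^2 = prod (x + c); a set T of even size is first reduced to odd
    size by moving a branch point to infinity. Elements x counted by N of degree
    e < d have d / e odd and thus at least 3, so they are few. For d = 2 there
    are no 2-superirreducible polynomials at all. *)

(** * Point count on a hyperelliptic curve *)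

Definition is_square (L : finFieldType) (x : L) : bool := [exists y, y ^+ 2 == x].

Lemma is_squareP (L : finFieldType) (x : L) :
  reflect (exists y, y ^+ 2 = x) (is_square x).
Proof. exact: 'exists_eqP. Qed.

Lemma linear_dependence (K : fieldType) (T : finType) n (v : T -> 'rV[K]_n) :
  (n < #|T|)%N ->
  exists2 c : T -> K, (exists t, c t != 0) & \sum_t c t *: v t = 0.
Proof.
move=> lt_nT; pose M := \matrix_(i < #|T|) v (enum_val i).
have: kermx M != 0.
  by rewrite -mxrank_eq0 mxrank_ker subn_eq0 -ltnNge (leq_ltn_trans (rank_leq_col M)).
case/rowV0Pn => u /sub_kermxP uM0 u_neq0.
exists (fun t => u 0 (enum_rank t)).
  apply/existsP; apply: contraR u_neq0; rewrite negb_exists => /forallP u0.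
  apply/eqP/rowP => i; rewrite mxE.
  by have := u0 (enum_val i); rewrite negbK enum_valK => /eqP.
rewrite -[RHS]uM0 mulmx_sum_row.
transitivity (\sum_(t in T) u 0 (enum_rank t) *: v t); first exact: eq_bigl.
by rewrite big_enum_val; apply: eq_bigr => i _; rewrite rowK enum_valK.
Qed.

(** [s] is a power of the characteristic because [s ^ 2] is one. *)
Lemma Frobenius_sqrt_card (L : finFieldType) (s : nat) :
  #|L| = (s ^ 2)%N -> {morph (fun x : L => x ^+ s) : x y / x + y}.
Proof.
move=> cardL x y; have [p p_pr pcharL] := finPcharP L.
apply: exprDn_pchar; rewrite (eq_pnat _ (pcharf_eq pcharL)).
have: p.-nat #|L| by rewrite (card_pprimeChar pcharL) pnatX pnat_id.
by rewrite cardL pnatX orbF.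
Qed.

Lemma two_neq0 (L : finFieldType) : odd #|L| -> 2%:R != 0 :> L.
Proof.
move=> oddL; apply/negP => /eqP two0; have [p p_pr pcharL] := finPcharP L.
have p2 : p = 2%N by apply/eqP; rewrite -(dvdn_prime2 p_pr) // (dvdn_pcharf pcharL) two0.
have [n cardLp] : exists n, #|L| = (p ^ n)%N.
  by exists (logn p #|L|); exact: card_pprimeChar pcharL.
have := finNzRing_gt1 L; move: oddL.
by rewrite cardLp p2 oddX orbF => /eqP->.
Qed.

(* The order at infinity of x^i y^j on y^2 = h(x), with deg h = 2 g + 1. *)
Definition pole_order (g i j : nat) : nat := i.*2 + j * g.*2.+1.

Lemma pole_orderMD g s i1 j1 i2 j2 :
  pole_order g (s * i1 + i2) (s * j1 + j2) = (s * pole_order g i1 j1 + pole_order g i2 j2)%N.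
Proof. by rewrite /pole_order -!mul2n; lia. Qed.

Lemma pole_order_even g i j : ~~ odd j ->
  pole_order g i j = (i + j./2 * g.*2.+1).*2.
Proof.
by move=> /negbTE ej; rewrite /pole_order -[X in (X * _)%N]odd_double_half ej; lia.
Qed.

Lemma pole_order_odd g i j : odd j ->
  pole_order g i j = ((i + j./2 * g.*2.+1).*2 + g.*2.+1)%N.
Proof.
by move=> oj; rewrite /pole_order -[X in (X * _)%N]odd_double_half oj; lia.
Qed.

Section HyperellipticMonomials.

Variables (K : fieldType) (g : nat) (h : {poly K}).
Hypothesis size_h : size h = g.*2.+2.

(* On y^2 = h(x), x^i y^j equals [mono0 i j + y * mono1 i j]. *)
Definition mono0 (i j : nat) : {poly K} :=
  if odd j then 0 else 'X^i * h ^+ j./2.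
Definition mono1 (i j : nat) : {poly K} :=
  if odd j then 'X^i * h ^+ j./2 else 0.

Lemma horner_mono i j (x y : K) : y ^+ 2 = h.[x] ->
  (mono0 i j).[x] + y * (mono1 i j).[x] = x ^+ i * y ^+ j.
Proof.
move=> y2; rewrite /mono0 /mono1 -[in y ^+ j](odd_double_half j).
rewrite -mul2n exprD exprM y2.
by case: (odd j); rewrite !(hornerM, hornerXn, horner_exp, horner0) /=
  ?expr1 ?expr0; ring.
Qed.

Lemma h_neq0 : h != 0. Proof. by rewrite -size_poly_gt0 size_h. Qed.

Lemma size_mono i n : size ('X^i * h ^+ n) = (i + n * g.*2.+1).+1.
Proof.
have hn_neq0: h ^+ n != 0 by rewrite expf_neq0 ?h_neq0.
rewrite size_monicM ?monicXn // size_polyXn.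
move: hn_neq0; rewrite -size_poly_gt0 => hn_gt0.
rewrite -(prednK hn_gt0) size_exp size_h mulnC /=; lia.
Qed.

Lemma size_mono0_le i j m : (pole_order g i j <= m.*2.+1)%N ->
  (size (mono0 i j) <= m.+1)%N.
Proof.
rewrite /mono0; case: ifPn => [|ej]; first by rewrite size_poly0.
by rewrite size_mono pole_order_even //; lia.
Qed.

Lemma size_mono1_le i j m : (pole_order g i j <= m.*2.+1 + g.*2.+1)%N ->
  (size (mono1 i j) <= m.+1)%N.
Proof.
rewrite /mono1; case: ifPn => [oj|]; last by rewrite size_poly0.
by rewrite size_mono pole_order_odd //; lia.
Qed.

(** Among the terms with nonzero coefficient, the one of largest pole order is unique, and nothing
    cancels its leading coefficient in the component where it lives. *)
Lemma mono_free (T : finType) (c : T -> K) (i j : T -> nat) :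
    injective (fun t => pole_order g (i t) (j t)) -> (exists t, c t != 0) ->
  (\sum_t c t *: mono0 (i t) (j t) != 0) || (\sum_t c t *: mono1 (i t) (j t) != 0).
Proof.
move=> inj_ord [t1 ct1]; pose ord t := pole_order g (i t) (j t).
case: (@arg_maxnP T t1 (fun t => c t != 0) ord ct1) => t0 ct0 max_t0.
have lt_ord t : t != t0 -> c t != 0 -> (ord t < ord t0)%N.
  move=> ne /max_t0 /=; rewrite leq_eqVlt => /orP[/eqP/inj_ord e|//].
  by rewrite e eqxx in ne.
pose e := (i t0 + (j t0)./2 * g.*2.+1)%N.
have lead_neq0 : ('X^(i t0) * h ^+ (j t0)./2)`_e != 0.
  rewrite -[e]/(e.+1.-1) -(size_mono (i t0) (j t0)./2) -lead_coefE lead_coef_eq0.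
  by rewrite mulf_neq0 ?expf_neq0 ?h_neq0 ?polyX_eq0 // -size_poly_gt0 size_polyX.
case: (boolP (odd (j t0))) => jt0; apply/orP; [right | left];
  apply: contraNneq lead_neq0 => /(congr1 (coefp e));
  rewrite /= coef_sum coef0 (bigD1 t0) //= big1 ?addr0 => [|t ne].
- by rewrite coefZ /mono1 jt0 => /eqP; rewrite mulf_eq0 (negbTE ct0).
- have [->|ct] := eqVneq (c t) 0; first by rewrite scale0r coef0.
  rewrite coefZ nth_default ?mulr0 //.
  have := lt_ord t ne ct; rewrite /ord (pole_order_odd _ _ jt0) -/e.
  (* For [e = 0] the size bound is too weak, but an odd monomial would have order at least
     [g.*2.+1], which [lt_o] excludes. *)
  case: e => [|e1] lt_o; last by apply: size_mono1_le; lia.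
  rewrite /mono1; case: ifPn => [oj|]; last by rewrite size_poly0.
  by move: lt_o; rewrite (pole_order_odd _ _ oj); lia.
- by rewrite coefZ /mono0 (negbTE jt0) => /eqP; rewrite mulf_eq0 (negbTE ct0).
have [->|ct] := eqVneq (c t) 0; first by rewrite scale0r coef0.
rewrite coefZ nth_default ?mulr0 //.
have := lt_ord t ne ct; rewrite /ord (pole_order_even _ _ jt0) -/e.
by case: e => [|e1] lt_o; [|apply: size_mono0_le]; lia.
Qed.

(** When both are nonzero, [a ^+ 2] has even degree and [h * b ^+ 2] odd degree, so they cannot
    cancel. *)
Lemma hyperelliptic_norm_neq0 (a b : {poly K}) :
  (a != 0) || (b != 0) -> a ^+ 2 - h * b ^+ 2 != 0.
Proof.
have h0 : h != 0 := h_neq0.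
rewrite subr_eq0; have [-> | b0] := eqVneq b 0.
  by rewrite orbF expr0n mulr0 expf_eq0.
move=> _; have [->|a0] := eqVneq a 0.
  by rewrite expr0n eq_sym mulf_neq0 ?expf_neq0.
apply/eqP => /(congr1 (fun p : {poly K} => size p)) /=.
rewrite !expr2 !size_mul ?mulf_neq0 // size_h.
by move: a0 b0; rewrite -!size_poly_gt0; move: (size a) (size b) => A B; lia.
Qed.

End HyperellipticMonomials.

Section Stepanov.

Variables (L : finFieldType) (s g : nat) (h : {poly L}).
Hypotheses (card_L : #|L| = (s ^ 2)%N) (s_odd : odd s).
Hypotheses (size_h : size h = g.*2.+2) (lt_g_s : (g.+1 ^ 2 < s)%N).

Local Notation lam := s./2.
Local Notation I := ('I_lam.+1 + 'I_(lam - g))%type.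
Local Notation J := ('I_(lam + g).+1 + 'I_lam.+1)%type.

(* [inl i] stands for the monomial x^i and [inr i] for x^i y. *)
Definition sum_idx a b (u : 'I_a + 'I_b) : nat :=
  match u with inl i => i | inr i => i end.
Definition sum_tag a b (u : 'I_a + 'I_b) : nat :=
  if u is inr _ then 1%N else 0%N.
Definition sum_order a b (u : 'I_a + 'I_b) : nat :=
  pole_order g (sum_idx u) (sum_tag u).

Let s_half : s = lam.*2.+1.
Proof. by rewrite -[LHS]odd_double_half s_odd. Qed.

Let le_g_lam : (g <= lam)%N.
Proof. by move: lt_g_s s_half; rewrite -mulnn; nia. Qed.

(** Monomials without [y] have even order, those with [y] odd order. *)
Lemma sum_order_inj a b : injective (@sum_order a b).
Proof.
by case=> [[i lti]|[i lti]] [[j ltj]|[j ltj]]; rewrite /sum_order /pole_order /=;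
  move=> e; try (congr inl; apply: val_inj => /=); try (congr inr; apply: val_inj => /=);
  lia.
Qed.

Lemma sum_order_I (w : I) : (sum_order w < s)%N.
Proof.
by case: w => [[i lti]|[i lti]]; rewrite /sum_order /pole_order /=; lia.
Qed.

Lemma sum_order_J (v : J) : (sum_order v <= s + g.*2)%N.
Proof.
by case: v => [[i lti]|[i lti]]; rewrite /sum_order /pole_order /=; lia.
Qed.

(** With [s = 2 lam + 1] the two sides are [s ^ 2 + g + 1] and [(s - g) (s + g + 1)], so this is
    exactly the hypothesis [(g + 1) ^ 2 < s]. *)
Let card_IJ : ((lam * lam.+1).*2 + g.+1 + (lam * lam.+1).*2.+1 < #|{: I * J}|)%N.
Proof.
rewrite card_prod !card_sum !card_ord.
have : (g.+1 * g.+1 < lam.*2.+1)%N by rewrite mulnn -s_half.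
rewrite -(subnKC le_g_lam) addKn; move: (lam - g)%N => r.
by rewrite -!mul2n; lia.
Qed.

Definition coord_x (p : I * J) := (s * sum_idx p.1 + sum_idx p.2)%N.
Definition coord_y (p : I * J) := (s * sum_tag p.1 + sum_tag p.2)%N.

(* The pairs in I * J index products w^s v of monomials with w of pole order
   < s and v of pole order <= s + 2 g; they outnumber the coefficients of the
   functions of pole order <= s^2 + 2 g, hence are dependent on the curve. *)
Lemma auxiliary_coefficients :
  exists2 c : I * J -> L, (exists p, c p != 0) &
    forall x y, y ^+ 2 = h.[x] -> \sum_p c p * (x ^+ coord_x p * y ^+ coord_y p) = 0.
Proof.
(* Pole order at most [s ^ 2 + 2 g] allows degree [(s ^ 2 - 1) / 2 + g] in the part without [y] and
   [(s ^ 2 - 1) / 2] in the part with [y]; here [(s ^ 2 - 1) / 2 = (lam * lam.+1).*2]. *)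
pose v p := row_mx
  (poly_rV (mono0 h (coord_x p) (coord_y p)) : 'rV_((lam * lam.+1).*2 + g.+1))
  (poly_rV (mono1 h (coord_x p) (coord_y p)) : 'rV_(lam * lam.+1).*2.+1).
have [c c_neq0 cv0] := linear_dependence v card_IJ.
exists c => // x y y2.
have order_le p : (pole_order g (coord_x p) (coord_y p) <=
    ((lam * lam.+1).*2 + g).*2.+1)%N.
  have -> : pole_order g (coord_x p) (coord_y p) =
      (s * sum_order p.1 + sum_order p.2)%N by exact: pole_orderMD.
  have oI : (sum_order p.1 <= lam.*2)%N by rewrite -ltnS -s_half sum_order_I.
  have := leq_mul (leqnn s) oI; have := sum_order_J p.2.
  have : (s * lam.*2 + s = ((lam * lam.+1).*2).*2.+1)%N.
    by move: s_half; move: (s./2) => r ->; lia.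
  by lia.
have A0 : \sum_p c p *: mono0 h (coord_x p) (coord_y p) = 0.
  have := congr1 (rVpoly \o lsubmx) cv0; rewrite /= !linear_sum !linear0 => e0; rewrite -[RHS]e0.
  apply: eq_bigr => p _; rewrite !linearZ /v /= row_mxKl poly_rV_K // addnS.
  exact: (size_mono0_le size_h (order_le p)).
have B0 : \sum_p c p *: mono1 h (coord_x p) (coord_y p) = 0.
  have := congr1 (rVpoly \o rsubmx) cv0; rewrite /= !linear_sum !linear0 => e0; rewrite -[RHS]e0.
  apply: eq_bigr => p _; rewrite !linearZ /v /= row_mxKr poly_rV_K //.
  by apply: (size_mono1_le size_h); rewrite (leq_trans (order_le p)) //; lia.
transitivity ((0 : {poly L}).[x] + y * (0 : {poly L}).[x]); last first.
  by rewrite !horner0 mulr0 addr0.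
rewrite -[X in X.[x] + _]A0 -[X in _ * X.[x]]B0 !horner_sum mulr_sumr -big_split /=.
by apply: eq_bigr => p _; rewrite -(horner_mono _ _ y2) !hornerZ; ring.
Qed.

(* Bombieri's form of Stepanov's method. The function a + b y vanishes at every
   rational point, and its norm a^2 - h b^2 vanishes doubly below the points
   with y <> 0. *)
Lemma hyperelliptic_point_bound :
  (#|[set x | h.[x] == 0%R]| +
    2 * #|[set x | (h.[x] != 0%R) && is_square h.[x]]|
     < s ^ 2 + g.*2.+1 * s)%N.
Proof.
have h0 : h != 0 := h_neq0 size_h.
have [c c_neq0 c0] := auxiliary_coefficients.
(* The exponent [s] moves from the factor indexed by [I] to the one indexed by [J]. *)
pose i (p : I * J) := (s * sum_idx p.2 + sum_idx p.1)%N.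
pose j (p : I * J) := (s * sum_tag p.2 + sum_tag p.1)%N.
pose a := \sum_p c p ^+ s *: mono0 h (i p) (j p).
pose b := \sum_p c p ^+ s *: mono1 h (i p) (j p).
have s_gt0 : (0 < s)%N by rewrite s_half.
have L2_neq0 : 2%:R != 0 :> L by apply: two_neq0; rewrite card_L oddX s_odd orbT.
have expss (x : L) : x ^+ (s * s) = x by rewrite mulnn -card_L expf_card.
(* t^(s^2) = t on L, so (sum c^s w v^s)^s = sum c w^s v at rational points. *)
have ab0 x y : y ^+ 2 = h.[x] -> a.[x] + y * b.[x] = 0.
  move=> y2; suff: (a.[x] + y * b.[x]) ^+ s == 0.
    by rewrite expf_eq0 s_gt0 => /eqP.
  have -> : a.[x] + y * b.[x] = \sum_p c p ^+ s * (x ^+ i p * y ^+ j p).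
    rewrite !horner_sum mulr_sumr -big_split /=.
    by apply: eq_bigr => p _; rewrite -(horner_mono _ _ y2) !hornerZ; ring.
  rewrite (big_morph _ (Frobenius_sqrt_card card_L) (expr0n _ s)) eqn0Ngt s_gt0 /=.
  rewrite -(c0 x y y2); apply/eqP/eq_bigr => p _.
  rewrite !exprMn -!exprM expss; congr (_ * (_ * _)).
    by rewrite mulnDl exprD mulnAC exprM expss -exprD addnC [(_ * s)%N]mulnC.
  by rewrite mulnDl exprD mulnAC exprM expss -exprD addnC [(_ * s)%N]mulnC.
have order_ij p : pole_order g (i p) (j p) = (s * sum_order p.2 + sum_order p.1)%N.
  exact: pole_orderMD.
(* Factors from [I] have order below [s], so division by [s] recovers both orders from
   [s * sum_order p.2 + sum_order p.1], and the monomials have distinct orders. *)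
have ab_neq0 : (a != 0) || (b != 0).
  apply: (mono_free size_h) => [p1 p2|]; last first.
    by have [p cp] := c_neq0; exists p; rewrite expf_neq0.
  rewrite !order_ij => e.
  have e1 := congr1 (modn^~ s) e; rewrite /= ![(s * _)%N]mulnC !modnMDl in e1.
  rewrite !modn_small ?sum_order_I // in e1.
  move: e; rewrite e1 => /addIn/eqP; rewrite eqn_pmul2l // => /eqP/sum_order_inj e2.
  by move/sum_order_inj: e1 e2; case: p1 p2 => [? ?] [? ?] /= -> ->.
(* The sum is even because [s] is odd, and [M.*2.+1 = s (s + 2 g) + (s - 1)] is the largest pole
   order possible. *)
have [M defM] : exists M, (s ^ 2 + g.*2.+1 * s = M.*2.+2)%N.
  exists (s * lam + (g.+1 * s).-1)%N.
  have : (s * s = s * lam.*2 + s)%N by rewrite -mulnSr -s_half.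
  by rewrite -mulnn; move: s_gt0; nia.
have le_gM : (g <= M)%N by move: defM s_gt0; nia.
have order_le p : (pole_order g (i p) (j p) <= M.*2.+1)%N.
  rewrite order_ij -ltnS -defM.
  have := leq_mul (leqnn s) (sum_order_J p.2); have := sum_order_I p.1.
  by rewrite -mulnn; lia.
have size_a : (size a <= M.+1)%N.
  apply: (big_ind (fun p : {poly L} => size p <= M.+1)%N) => [|p q sp sq|p _].
  - by rewrite size_poly0.
  - by rewrite (leq_trans (size_polyD _ _)) // geq_max sp.
  by rewrite (leq_trans (size_scale_leq _ _)) // (size_mono0_le size_h).
have size_b : (size b <= (M - g).+1)%N.
  apply: (big_ind (fun p : {poly L} => size p <= (M - g).+1)%N) => [|p q sp sq|p _].
  - by rewrite size_poly0.
  - by rewrite (leq_trans (size_polyD _ _)) // geq_max sp.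
  rewrite (leq_trans (size_scale_leq _ _)) // (size_mono1_le size_h) //.
  by rewrite (leq_trans (order_le p)) //; lia.
pose D := a ^+ 2 - h * b ^+ 2.
have D_neq0 : D != 0 := hyperelliptic_norm_neq0 size_h ab_neq0.
have size_D : (size D <= M.*2.+2)%N.
  rewrite (leq_trans (size_polyD _ _)) // geq_max size_polyN; apply/andP; split.
    by rewrite (leq_trans (size_poly_exp_leq _ _)) //; lia.
  rewrite (leq_trans (size_polyMleq _ _)) // size_h.
  have := size_poly_exp_leq b 2; move: size_b le_gM.
  by move: (size b) (size (b ^+ 2)) => A B; lia.
set Z := [set x | h.[x] == 0]; set S := [set x | _ && _].
pose P := \prod_(x in S) ('X - x%:P).
have P_monic : P \is monic by apply: monic_prod_XsubC.
have size_P : size P = #|S|.+1 by rewrite /P -big_enum size_prod_XsubC -cardE.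
have dvdP p : (forall x, x \in S -> p.[x] = 0) -> P %| p.
  move=> p0; rewrite /P -big_enum; apply: uniq_roots_dvdp.
    by apply/allP => x; rewrite mem_enum => /p0/rootP.
  by rewrite uniq_rootsE enum_uniq.
(* Both [y] and [- y] lie above [x]; since [2] and [y] are nonzero, the two relations force both
   values to vanish. *)
have ab_S x : x \in S -> a.[x] = 0 /\ b.[x] = 0.
  rewrite inE => /andP[hx0 /is_squareP[y y2]].
  have y0 : y != 0 by apply: contraNneq hx0 => y0; rewrite -y2 y0 expr0n.
  have e1 := ab0 _ _ y2; have e2 : a.[x] + - y * b.[x] = 0 by apply: ab0; rewrite sqrrN.
  have b2 : 2%:R * (y * b.[x]) = 0.
    by transitivity ((a.[x] + y * b.[x]) - (a.[x] + - y * b.[x])); [ring | rewrite e1 e2 subr0].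
  move/eqP: b2; rewrite !mulf_eq0 (negbTE y0) /= (negbTE L2_neq0) /= => /eqP bx0.
  by move: e1; rewrite bx0 mulr0 addr0.
have /dvdpP[a' defa] : P %| a by apply: dvdP => x /ab_S[].
have /dvdpP[b' defb] : P %| b by apply: dvdP => x /ab_S[].
pose D' := a' ^+ 2 - h * b' ^+ 2.
have defD : D = P ^+ 2 * D' by rewrite /D defa defb /D'; ring.
have D'_neq0 : D' != 0 by apply: contraNneq D_neq0 => e; rewrite defD e mulr0.
(* Above a zero of [h] lies the point with [y = 0], so [D] vanishes there; [P] does not, so [D']
   does. *)
have lt_Z : (size (enum Z) < size D')%N.
  apply: max_poly_roots => //; last by rewrite enum_uniq.
  apply/allP => x; rewrite mem_enum inE => /eqP hx0.
  have /eqP : D.[x] = 0.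
    have := ab0 x 0; rewrite mul0r addr0 hx0 expr0n => /(_ erefl) ax0.
    by rewrite /D hornerD hornerN horner_exp hornerM ax0 hx0 expr0n mul0r subr0.
  rewrite defD hornerM mulf_eq0 rootE horner_exp expf_eq0 /= => /orP[|//].
  move=> Px0; have: root P x by [].
  by rewrite /P -big_enum root_prod_XsubC mem_enum inE hx0 eqxx.
move: lt_Z size_D; rewrite -cardE defD size_monicM ?rpredX // expr2.
rewrite size_monicM ?monic_neq0 // size_P -defM.
by move: (size D') => A; lia.
Qed.

End Stepanov.

(** * Quadratic character sums *)

Lemma is_square0 (L : finFieldType) : is_square (0 : L).
Proof. by apply/is_squareP; exists 0; rewrite expr0n. Qed.

Lemma expf_card_pred (L : finFieldType) (x : L) : odd #|L| -> x != 0 ->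
  x ^+ (#|L|./2).*2 = 1.
Proof.
move=> oddL x0; apply: (mulfI x0); rewrite -exprS mulr1.
by rewrite -[X in _ ^+ X]/(true + _)%N -oddL odd_double_half expf_card.
Qed.

Lemma half_card_gt0 (L : finFieldType) : odd #|L| -> (0 < #|L|./2)%N.
Proof.
have: (1 < #|L|)%N := finNzRing_gt1 L.
by case: #|L| => [|[|[|n]]].
Qed.

(** A generator [u] of the unit group has order [2 * #|L|./2], so raising [u ^+ i] to the power
    [#|L|./2] gives 1 only for even [i]. *)
Lemma Euler_criterion (L : finFieldType) (x : L) : odd #|L| -> x != 0 ->
  is_square x = (x ^+ #|L|./2 == 1).
Proof.
move=> oddL x0; apply/is_squareP/eqP => [[y y2]|].
  rewrite -y2 -exprM mul2n expf_card_pred //.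
  by apply: contraNneq x0 => y0; rewrite -y2 y0 expr0n.
have /cyclicP[u def_u] := field_unit_group_cyclic [set: {unit L}].
have := in_setT (finField_unit x0); rewrite def_u => /cycleP[i /(congr1 val)].
rewrite FinRing.val_unitX /= => ->; rewrite -exprM => /eqP.
rewrite -FinRing.val_unitX -FinRing.val_unit1 val_eqE -order_dvdn orderE -def_u.
have := odd_double_half #|L|; rewrite card_finField_unit oddL add1n => defL; rewrite -[in X in (X %| _)%N]defL /=.
rewrite -mul2n dvdn_pmul2r; last exact: half_card_gt0.
by case/dvdnP => m ->; exists (FinRing.uval u ^+ m); rewrite -exprM.
Qed.

Definition qchar (L : finFieldType) (x : L) : int :=
  if x == 0 then 0 else if is_square x then 1 else -1.

Lemma qcharM (L : finFieldType) : odd #|L| -> {morph @qchar L : x y / x * y}.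
Proof.
move=> oddL x y; rewrite /qchar mulf_eq0.
have [->|x0] := eqVneq x 0; first by rewrite /= mul0r.
have [->|y0] := eqVneq y 0; first by rewrite orbT mulr0.
rewrite /= !Euler_criterion ?mulf_neq0 // exprMn.
have sgn (z : L) : z != 0 -> (z ^+ #|L|./2 == 1) || (z ^+ #|L|./2 == -1).
  by move=> z0; rewrite -eqf_sqr expr1n -exprM muln2 expf_card_pred.
have N1 : (-1 == 1 :> L) = false.
  by apply: contraNF (two_neq0 oddL) => /eqP N1; rewrite mulr2n -[X in X + _]N1 addNr.
by case/orP: (sgn x x0) => /eqP->; case/orP: (sgn y y0) => /eqP->;
  rewrite ?mulrNN ?mulr1 ?mul1r ?N1 ?eqxx ?mulrNN ?mulr1 ?mul1r.
Qed.

Lemma qchar0 (L : finFieldType) : qchar (0 : L) = 0.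
Proof. by rewrite /qchar eqxx. Qed.

Lemma qchar_sqr (L : finFieldType) (x : L) : x != 0 -> qchar (x ^+ 2) = 1.
Proof.
move=> x0; rewrite /qchar expf_eq0 (negbTE x0) /= ifT //.
by apply/is_squareP; exists x.
Qed.

Lemma qchar1 (L : finFieldType) : qchar (1 : L) = 1.
Proof. by rewrite -[X in qchar X](expr1n _ 2) qchar_sqr ?oner_neq0. Qed.

Lemma qchar_prod (L : finFieldType) (I : finType) (P : pred I) (f : I -> L) :
  odd #|L| -> qchar (\prod_(i | P i) f i) = \prod_(i | P i) qchar (f i).
Proof. by move=> oddL; rewrite (big_morph (@qchar L) (qcharM oddL) (qchar1 L)). Qed.

(* [char_weight n * sqrt #|L|] bounds the character sum of a product of n > 0
   distinct linear factors. *)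
Definition char_weight (n : nat) : nat := if odd n then n else n.-1.

(** Pair [T] with its complement: one size is odd and one even, so the weights add up to [#|I|.-1].
    The pair of the empty and full sets gives [#|I|] instead, as [0.-1 = 0]; it is met twice. *)
Lemma sum_char_weight (I : finType) : odd #|I| ->
  (2 * \sum_(T : {set I}) char_weight #|T| = 2 ^ #|I| * #|I|.-1 + 2)%N.
Proof.
move=> oddI; rewrite mul2n -addnn.
rewrite [X in (_ + X)%N](reindex_inj (@setC_inj I)) -big_split /=.
have weightC (T : {set I}) : (char_weight #|T| + char_weight #|~: T| =
    #|I|.-1 + ((T == set0) + (T == setT)))%N.
  have [->|T0] := eqVneq T set0.
    rewrite setC0 cards0 cardsT /char_weight oddI /= eq_sym -cards_eq0 cardsT.
    by move: oddI; case: #|I| => [|n] //= _; lia.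
  have [->|T1] := eqVneq T setT.
    by rewrite setCT cards0 cardsT /char_weight oddI /=; move: oddI; case: #|I| => [|n] //= _; lia.
  have TC0 : ~: T != set0 by rewrite -setCT (inj_eq (@setC_inj I)).
  have := cardsC T; move: T0 TC0; rewrite -!cards_eq0.
  rewrite /char_weight; move: oddI; move: #|T| #|~: T| => m n.
  by move=> oddI m0 n0 defI; move: oddI; rewrite -defI oddD; case: (odd m) (odd n) => [] []; lia.
rewrite (eq_bigr _ (fun T _ => weightC T)) big_split /= sum_nat_const.
rewrite big_split /= -!big_mkcond /= !big_pred1_eq.
by rewrite -cardsT -powersetT card_powerset cardsT.
Qed.

Section Weil.

Variables (L : finFieldType) (s : nat).
Hypotheses (card_L : #|L| = (s ^ 2)%N) (s_odd : odd s).

Let oddL : odd #|L|. Proof. by rewrite card_L oddX s_odd orbT. Qed.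

(** If [Z], [S], [N] count the zero, nonzero square and nonsquare values, the sum is
    [S - N = Z + 2 S - s ^ 2], and the point bound applies. *)
Lemma qchar_poly_sum_lt (g : nat) (h : {poly L}) :
    size h = g.*2.+2 -> (g.+1 ^ 2 < s)%N ->
  \sum_x qchar h.[x] < (g.*2.+1 * s)%N%:R.
Proof.
move=> size_h lt_gs; have := hyperelliptic_point_bound card_L s_odd size_h lt_gs.
set Z := #|_|; set S := #|_|; pose N := #|[set x | (h.[x] != 0) && ~~ is_square h.[x]]|.
have cardN : (Z + (S + N) = s ^ 2)%N.
  rewrite -card_L -(cardsC [set x | h.[x] == 0]) -/Z.
  rewrite -(cardsID [set x | is_square h.[x]] (~: _)).
  congr (_ + (_ + _))%N; apply: eq_card => x; rewrite !inE //.
  by rewrite andbC.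
suff -> : \sum_x qchar h.[x] = S%:R - N%:R by move: cardN; move: N; lia.
rewrite (bigID (fun x => h.[x] == 0)) /= big1 => [|x /eqP->]; last exact: qchar0.
rewrite add0r (bigID (fun x => is_square h.[x])) /=; congr (_ + _).
  rewrite /S -sum1_card natr_sum; apply: eq_big => [x|x /andP[hx0 sq]]; first by rewrite inE.
  by rewrite /qchar (negbTE hx0) sq.
rewrite /N -sum1_card natr_sum -sumrN; apply: eq_big => [x|x /andP[hx0 sq]]; first by rewrite inE.
by rewrite /qchar (negbTE hx0) (negbTE sq).
Qed.

(** Scaling [h] by a nonsquare flips the sign of the sum, which turns the upper bound into a lower
    one. *)
Lemma qchar_poly_sum_norm_lt (g : nat) (h : {poly L}) :
    size h = g.*2.+2 -> (g.+1 ^ 2 < s)%N ->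
  `|\sum_x qchar h.[x]| < (g.*2.+1 * s)%N%:R.
Proof.
move=> size_h lt_gs; rewrite ltr_norml qchar_poly_sum_lt // andbT.
have [/existsP[a Na]|] := boolP [exists a : L, ~~ is_square a].
  have a0 : a != 0 by apply: contraNneq Na => ->; exact: is_square0.
  have qa : qchar a = -1 by rewrite /qchar (negbTE a0) (negbTE Na).
  rewrite ltrNl -sumrN (eq_bigr (fun x => qchar (a *: h).[x])) => [|x _].
    by apply: qchar_poly_sum_lt; rewrite // size_scale.
  by rewrite hornerZ qcharM // qa mulN1r.
rewrite negb_exists => /forallP allsq.
have sum_ge0 : 0 <= \sum_x qchar h.[x].
  by apply: sumr_ge0 => x _; rewrite /qchar; case: ifP => // _; move: (allsq h.[x]); rewrite negbK => ->.
apply: lt_le_trans sum_ge0; rewrite oppr_lt0 ltr0n muln_gt0 /=.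
by case: s s_odd.
Qed.

Section LinearFactors.

Variables (I : finType) (f : I -> L).
Hypothesis f_inj : injective f.

Definition char_sum (T : {set I}) : int :=
  \sum_x qchar (\prod_(c in T) (x + f c)).

Lemma char_sum_set0 : char_sum set0 = (s ^ 2)%:R.
Proof.
rewrite /char_sum (eq_bigr (fun=> 1)) => [|x _]; last by rewrite big_set0 qchar1.
by rewrite sumr_const card_L.
Qed.

Lemma char_sum_odd (T : {set I}) : odd #|T| -> (uphalf #|T| ^ 2 < s)%N ->
  `|char_sum T| <= (#|T| * s)%:R.
Proof.
move=> oddT lt_s; pose h := \prod_(c in T) ('X - (- f c)%:P).
have defT : #|T| = (#|T|./2).*2.+1 by rewrite -[LHS]odd_double_half oddT.
have size_h : size h = (#|T|./2).*2.+2.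
  by rewrite /h -big_enum size_prod_XsubC -cardE -defT.
have -> : char_sum T = \sum_x qchar h.[x].
  apply: eq_bigr => x _; congr qchar; rewrite horner_prod; apply: eq_bigr => c _.
  by rewrite !hornerE opprK.
rewrite [X in (X * s)%N]defT; apply/ltW/qchar_poly_sum_norm_lt => //.
by move: lt_s; rewrite uphalf_half oddT.
Qed.

(* Inverting about the branch point [- f c0] moves it to infinity, which lowers
   the degree by one and makes it odd. *)
Lemma char_sum_even (T : {set I}) :
    ~~ odd #|T| -> T != set0 -> (uphalf #|T| ^ 2 < s)%N ->
  `|char_sum T| <= (#|T|.-1 * s)%:R.
Proof.
move=> evenT /set0Pn[c0 Tc0] lt_s.
(* For [x = w^-1 - f c0] with [w] nonzero, [x + f c = w^-1 * (d c * w + 1)]. *)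
pose d c := f c - f c0; pose h := \prod_(c in T :\ c0) ((d c) *: 'X + 1).
have cardT' : #|T| = #|T :\ c0|.+1 by rewrite (cardsD1 c0) Tc0.
have [g defT] : exists g, #|T| = g.*2.+2.
  exists (#|T|./2).-1; move: evenT cardT'; move: #|T| #|_ :\ _| => m n; lia.
have size_h : size h = g.*2.+2.
  have size_factor c : c \in T :\ c0 -> size ((d c) *: 'X + 1) = 2%N.
    rewrite !inE => /andP[ne_c _]; have d0 : d c != 0 by rewrite subr_eq0 inj_eq.
    by rewrite size_polyDl size_scale ?size_polyX ?size_poly1.
  rewrite /h size_prod => [|c Tc]; last by rewrite -size_poly_gt0 size_factor.
  rewrite (eq_bigr (fun=> 2%N)) // sum_nat_const.
  by rewrite -defT cardT'; move: #|_| => m; lia.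
have h0 : h.[0] = 1.
  by rewrite horner_prod big1 // => c _; rewrite hornerD hornerZ hornerX hornerC mulr0 add0r.
(* With [0^-1 = 0] the substitution is a bijection of [L]. At [w = 0] the original product vanishes
   while [h.[0] = 1], whence the [- 1]. *)
have -> : char_sum T = \sum_x qchar h.[x] - 1.
  rewrite [in RHS](bigD1 0) //= h0 qchar1 addrAC subrr add0r.
  rewrite /char_sum (reindex_onto (fun w => w^-1 - f c0) (fun x => (x + f c0)^-1)) /=;
    last by move=> x _; rewrite invrK addrK.
  rewrite (eq_bigl xpredT) => [|w]; last by rewrite subrK invrK eqxx.
  rewrite (bigD1 0) //= (bigD1 c0) //= invr0 sub0r addNr mul0r qchar0 add0r.
  apply: eq_bigr => w w0.
  (* As [#|T|] is even, [w ^+ #|T|] is a square and clears the denominators without changing the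
     character. *)
  have wT0 : w ^+ #|T|./2 != 0 by rewrite expf_neq0.
  rewrite -[LHS]mul1r -(qchar_sqr wT0) -qcharM //; congr qchar.
  rewrite -exprM muln2 even_halfK // -prodr_const -big_split /= (bigD1 c0) //=.
  rewrite subrK mulfV // mul1r horner_prod.
  apply: eq_big => [c|c _]; first by rewrite !inE andbC.
  by rewrite mulrDr mulrDr mulfV // /d hornerD hornerZ hornerX hornerC; ring.
(* The strict bound over the integers absorbs the [- 1]. *)
have := qchar_poly_sum_norm_lt size_h.
have -> : (g.+1 ^ 2 < s)%N.
  by move: lt_s; rewrite defT uphalf_half /= negbK odd_double doubleK.
move=> /(_ isT); rewrite defT /=; move: (\sum_x _) => A.
by move: (_ * s)%N => B; lia.
Qed.

Lemma char_sum_le (T : {set I}) : T != set0 -> (uphalf #|T| ^ 2 < s)%N ->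
  `|char_sum T| <= (char_weight #|T| * s)%:R.
Proof.
rewrite /char_weight; case: ifPn => [oddT _|]; first exact: char_sum_odd.
exact: char_sum_even.
Qed.

Definition nonsquare_translates : {set L} :=
  [set x | [forall c, ~~ is_square (x + f c)]].

(** A nonzero square among the translates kills the product. A zero translate only gives the factor
    1, but the hypothesis then supplies another translate that is a nonzero square. *)
Lemma prod_1sub_qchar (x : L) :
    (forall c, exists2 c', f c' != f c & is_square (f c' - f c)) ->
  \prod_c (1 - qchar (x + f c)) =
    (if x \in nonsquare_translates then 2 ^+ #|I| else 0) :> int.
Proof.
move=> sq_diff; rewrite inE; case: ifPn => [/forallP nsq|].
  rewrite -prodr_const; apply: eq_big => // c _; rewrite /qchar (negbTE (nsq c)) ifN //.
  by apply: contraNneq (nsq c) => ->; exact: is_square0.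
rewrite negb_forall => /existsP[c]; rewrite negbK => sqc.
have [c1 xc1 sqc1] : exists2 c1, x + f c1 != 0 & is_square (x + f c1).
  have [x0|] := eqVneq (x + f c) 0; last by exists c.
  have [c1 ne sq1] := sq_diff c; exists c1; last first.
    by move: sq1; rewrite -[f c1 - _]add0r -x0 addrACA subrr addr0.
  by apply: contra ne => /eqP x1; apply/eqP/(addrI x); rewrite x1.
by rewrite (bigD1 c1) //= /qchar (negbTE xc1) sqc1 subrr mul0r.
Qed.

(** In the expansion the empty set contributes [s ^ 2]; [char_sum_le] bounds the other terms and
    [sum_char_weight] adds up the bounds. *)
Lemma card_nonsquare_translates : odd #|I| -> (uphalf #|I| ^ 2 < s)%N ->
    (forall c, exists2 c', f c' != f c & is_square (f c' - f c)) ->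
  `|(2 ^ #|I| * #|nonsquare_translates|)%:R - (s ^ 2)%:R : int| * 2 <=
    (s * (2 ^ #|I| * #|I|.-1 + 2))%:R.
Proof.
move=> oddI lt_s sq_diff.
have -> : (2 ^ #|I| * #|nonsquare_translates|)%:R =
    \sum_(T : {set I}) \prod_(c in T) (-1) * char_sum T :> int.
  transitivity (\sum_x \prod_c (- qchar (x + f c) + 1)).
    rewrite (eq_bigr (fun x => if x \in nonsquare_translates then 2 ^+ #|I| else 0)).
      by rewrite -big_mkcond sumr_const natrM natrX -[RHS]mulr_natr.
    by move=> x _; rewrite -prod_1sub_qchar //; apply: eq_bigr => c _; rewrite addrC.
  under eq_bigr do rewrite bigA_distr.
  rewrite exchange_big /=; apply: eq_bigr => T _; rewrite mulr_sumr.
  apply: eq_bigr => x _; rewrite qchar_prod // -big_mkcond -big_split /=.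
  by apply: eq_bigr => c _; rewrite mulN1r.
rewrite (bigD1 set0) //= big_set0 mul1r char_sum_set0 addrAC subrr add0r.
rewrite -sum_char_weight // [in leRHS](bigD1 set0) //= cards0 add0n.
rewrite mulnCA natrM [leRHS]mulrC ler_pM2r //.
apply: le_trans (ler_norm_sum _ _ _) _.
rewrite big_distrr /= natr_sum; apply: ler_sum => T T0.
rewrite prodr_const normrM normrX normrN1 expr1n mul1r mulnC char_sum_le //.
apply: leq_ltn_trans lt_s; rewrite leq_sqr uphalf_leq //.
exact: max_card.
Qed.

End LinearFactors.

End Weil.

(** * Finite extensions *)

Lemma irreducible_factor (F : fieldType) (p : {poly F}) :
  (1 < size p)%N -> exists2 r, irreducible_poly r & r %| p.
Proof.
have [n] := ubnP (size p); elim: n p => // n IHn p lt_pn p_gt1.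
have [irr_p|red_p] := pselect (irreducible_poly p); first by exists p.
have [u [u_neq1 u_p neq_up]] : exists u : {poly F}, [/\ size u != 1%N, u %| p & ~~ (u %= p)].
  apply: contrapT => no_u; apply: red_p; split=> // u u_neq1 u_p.
  by apply: contraT => neq_up; case: no_u; exists u.
have p0 : p != 0 by rewrite -size_poly_gt0 ltnW.
have u0 : u != 0 by apply: contraNneq p0 => e; rewrite e dvd0p in u_p.
have u_gt1 : (1 < size u)%N by rewrite ltn_neqAle eq_sym u_neq1 size_poly_gt0.
have lt_up : (size u < size p)%N by rewrite ltn_neqAle dvdp_leq // andbT dvdp_size_eqp.
have [|r irr_r r_u] := IHn u _ u_gt1; first exact: leq_trans lt_up _.
by exists r; rewrite // (dvdp_trans r_u).
Qed.

(** The gcd, taken over [F], keeps the root [x]; it is therefore nonconstant and associate to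
    [p]. *)
Lemma irreducible_dvdp_root (F K : fieldType) (f : {rmorphism F -> K})
    (p q : {poly F}) (x : K) :
  irreducible_poly p -> root (map_poly f p) x -> root (map_poly f q) x -> p %| q.
Proof.
move=> [p_gt1 irr_p] px0 qx0.
have gcd_root : root (map_poly f (gcdp p q)) x by rewrite gcdp_map root_gcd px0.
have gcd0 : gcdp p q != 0 by rewrite gcdp_eq0 -size_poly_eq0 gtn_eqF // ltnW.
have gcd_gt1 : (1 < size (gcdp p q))%N.
  by rewrite -(size_map_poly f) (root_size_gt1 _ gcd_root) // map_poly_eq0.
rewrite -(eqp_dvdl q (irr_p _ _ (dvdp_gcdl p q))) ?dvdp_gcdr //.
by rewrite gtn_eqF.
Qed.

Section FiniteExtension.

Variable F : finFieldType.

(** In a splitting field of [X^m - X] the roots form the fixed field of the [d]-th power of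
    Frobenius, hence the whole field; being distinct, they are [m] in number. *)
Lemma exists_finite_extension (d : nat) : (0 < d)%N ->
  exists L : fieldExtType F, \dim {:L} = d.
Proof.
move=> d_gt0; pose m := (#|F| ^ d)%N.
have m_gt1 : (1 < m)%N by rewrite -(exp1n d) ltn_exp2r // finNzRing_gt1.
pose p (R : nzRingType) : {poly R} := 'X^m - 'X.
have Dp R : p R = ('X^(m.-1) - 1) * ('X - 0%:P).
  by rewrite subr0 mulrBl mul1r -exprSr prednK // ltnW.
have m1_gt0 : (0 < m.-1)%N by rewrite -ltnS prednK // ltnW.
have /FinSplittingFieldFor[/= L splitL]: p F != 0.
  by rewrite Dp monic_neq0 ?rpredM ?monicXsubC ?monicXnsubC.
have defpL : map_poly (in_alg L) (p F) = p L by rewrite rmorphB rmorphXn /= map_polyX.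
rewrite [X in splittingFieldFor _ X _]defpL in splitL.
exists L.
have /finField_galois_generator[/= a _ Da]: (1 <= {:L})%VS by apply: sub1v.
pose E := fixedSpace (a ^+ d)%g; rewrite dimv1 expn1 in Da.
have [zs DpL defL] := splitL.
have mL0 : m%:R = 0 :> L.
  have [q q_pr pcharF] := finPcharP F.
  have [n cardF] : exists n, #|F| = (q ^ n)%N.
    by exists (logn q #|F|); exact: card_pprimeChar pcharF.
  have n_gt0 : (0 < n)%N by have := finNzRing_gt1 F; rewrite cardF; case: n cardF.
  have pcharL : q \in [pchar L] by rewrite pchar_lalg.
  by rewrite /m cardF -expnM natrX pcharf0 // expr0n muln_eq0 !gtn_eqF.
(* [X^(m-1) - 1] is separable because [m - 1] equals [-1] in [L]. *)
have Uzs : uniq zs.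
  rewrite -separable_prod_XsubC -(eqp_separable DpL) Dp separable_root andbC.
  rewrite /root !hornerE subr_eq0 eq_sym expr0n gtn_eqF ?oner_eq0 //=.
  rewrite cyclotomic.separable_Xn_sub_1 // -subn1 natrB 1?ltnW // mL0.
  by rewrite sub0r oppr_eq0 oner_eq0.
have in_zs : zs =i E.
  move=> z; rewrite -root_prod_XsubC -(eqp_root DpL) (sameP fixedSpaceP eqP).
  rewrite /root !hornerE subr_eq0 /= /m; congr (_ == z).
  elim: (d) => [|i IHi]; first by rewrite gal_id.
  by rewrite expgSr expnSr exprM IHi galM ?Da ?memvf.
have defE : E = {:L}%VS.
  apply/eqP; rewrite eqEsubv subvf -defL -[E]subfield_closed agenvS //.
  by rewrite subv_add sub1v; apply/span_subvP=> z; rewrite in_zs.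
have cardL : #|finvect_type L| = m.
  have /eq_card-> : finvect_type L =i zs by move=> z; rewrite in_zs defE memvf.
  apply: succn_inj; rewrite (card_uniqP _) //= -(size_prod_XsubC _ id).
  by rewrite -(eqp_size DpL) size_polyDl size_polyXn // size_polyN size_polyX.
have := card_vspace {:finvect_type L}%VS; rewrite card_vspacef cardL => /eqP.
by rewrite /m eqn_exp2l ?finNzRing_gt1 // => /eqP.
Qed.

Lemma minimal_polynomial (M : fieldExtType F) (x : M) :
  exists p : {poly F}, [/\ p \is monic, irreducible_poly p,
    root (map_poly (in_alg M) p) x, ((size p).-1 %| \dim {:M})%N &
    x ^+ (#|F| ^ (size p).-1) = x].
Proof.
have /polyOver1P[p Dp] := minPolyOver 1 x.
have sp : size p = (adjoin_degree 1 x).+1 by rewrite -(size_map_poly (in_alg M)) -Dp size_minPoly.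
have dimx : \dim <<1; x>> = adjoin_degree 1 x by rewrite dim_Fadjoin dimv1 muln1.
exists p; split.
- by rewrite -(map_monic (in_alg M)) -Dp monic_minPoly.
- split=> [|u u_neq1 u_p]; first by rewrite sp ltnS -dimx adim_gt0.
  have Ku : map_poly (in_alg M) u \is a polyOver 1%AS by apply/polyOver1P; exists u.
  have := minPoly_irr (x := x) Ku; rewrite Dp dvdp_map => /(_ u_p) /orP[|]; first by rewrite eqp_map.
  by rewrite -size_poly_eq1 size_map_poly (negbTE u_neq1).
- by rewrite -Dp root_minPoly.
- by rewrite sp /= -dimx field_dimS ?subvf.
rewrite sp /= -dimx; apply/eqP.
by rewrite -(Fermat's_little_theorem <<1; x>>%AS) memv_adjoin.
Qed.

Lemma irreducible_root_degree (M : fieldExtType F) (p : {poly F}) (x : M) :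
    irreducible_poly p -> root (map_poly (in_alg M) p) x ->
  ((size p).-1 %| \dim {:M})%N /\ x ^+ (#|F| ^ (size p).-1) = x.
Proof.
move=> irr_p px0; have [r [_ irr_r rx0 dvd_r x_r]] := minimal_polynomial x.
have -> // : size p = size r; apply/eqp_size.
by rewrite /eqp !(irreducible_dvdp_root _ px0, irreducible_dvdp_root _ rx0).
Qed.

End FiniteExtension.

(** [(q ^ d - 1) / 2] is a multiple of [(q ^ e - 1) (q ^ e + 1) / 2], and [q ^ e + 1] is even. With
    Euler's criterion, nonzero elements of the subfield of order [q ^ e] are squares in the field of
    order [q ^ d]. *)
Lemma dvdn_half_expn_double (q e d : nat) : odd q -> (e.*2 %| d)%N ->
  (0 < d)%N -> ((q ^ e).-1 %| (q ^ d)./2)%N.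
Proof.
move=> q_odd /dvdnP[k ->]; case: k => // k _.
have : odd (q ^ e) by rewrite oddX q_odd orbT.
have -> : (q ^ (k.+1 * e.*2) = ((q ^ e) ^ 2) ^ k.+1)%N.
  by rewrite -!expnM; congr expn; lia.
move: (q ^ e)%N => r r_odd.
have [t ->] : exists t, r = t.*2.+1 by exists r./2; rewrite -[LHS]odd_double_half r_odd.
have -> : (t.*2.+1 ^ 2 = (t * t.+1).*2.*2.+1)%N by rewrite -mulnn; lia.
have [w defw] : exists w, (w = t * t.+1)%N by exists (t * t.+1)%N.
rewrite -defw /=.
have [v ->] : exists v, (w.*2.*2.+1 ^ k.+1 = (w * v).*2.*2.+1)%N.
  elim: k => [|k [v IH]]; first by exists 1%N; rewrite expn1 muln1.
  by exists (v + 4 * w * v + 1)%N; rewrite expnS IH; lia.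
by rewrite defw; apply/dvdnP; exists (t.+1 * v)%N; rewrite -!mul2n; lia.
Qed.

(** * The nonsquare criterion for 2-superirreducibility *)

Lemma card_finvect_type (F : finFieldType) (fT : fieldExtType F) :
  #|finvect_type fT| = (#|F| ^ \dim {:fT})%N.
Proof. by have := card_vspace {:finvect_type fT}%VS; rewrite card_vspacef. Qed.

Lemma odd_card_finvect_type (F : finFieldType) (fT : fieldExtType F) :
  odd #|F| -> odd #|finvect_type fT|.
Proof. by move=> oddF; rewrite card_finvect_type oddX oddF orbT. Qed.

Lemma size_comp_poly_gt1 (F : fieldType) (f g : {poly F}) :
  f != 0 -> (1 < size g)%N -> size (f \Po g) = ((size f).-1 * (size g).-1).+1.
Proof.
move=> f0 g_gt1; rewrite -size_comp_poly prednK // size_poly_gt0.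
by rewrite comp_poly_eq0.
Qed.

Section Superirreducible.

Variables (F : finFieldType) (d : nat).
Hypotheses (oddF : odd #|F|) (d_gt0 : (0 < d)%N) (d_even : ~~ odd d).

(** By Euler's criterion, this makes scalars squares in extensions of degree [d]; it uses that [d]
    is even. *)
Lemma in_alg_half_power (M : fieldExtType F) (a : F) : a != 0 ->
  (in_alg M a) ^+ (#|F| ^ d)./2 = 1.
Proof.
move=> a0; rewrite -rmorphXn -[RHS](rmorph1 (in_alg M)); congr (in_alg M _).
have /dvdnP[t ->] : (#|F|.-1 %| (#|F| ^ d)./2)%N.
  by rewrite -[in X in (X %| _)%N](expn1 #|F|) dvdn_half_expn_double // dvdn2.
rewrite mulnC exprM; have -> : #|F|.-1 = (#|F|./2).*2.
  by rewrite -[in LHS](odd_double_half #|F|) oddF.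
by rewrite expf_card_pred // expr1n.
Qed.

Section Root.

Variable fT : fieldExtType F.
Local Notation L := (finvect_type fT).
Hypothesis dimL : \dim {:fT} = d.

Variables (f : {poly F}) (x : L).
Hypotheses (irr_f : irreducible_poly f) (size_f : size f = d.+1).
Hypothesis fx0 : root (map_poly (in_alg L) f) x.

(** A square root of [x + c] in [L] would be a root of the irreducible [f(t^2 - c)], whose degree
    [2 d] would have to divide [d]. *)
Lemma superirreducible2_nonsquare (c : F) :
  superirreducible2 f -> ~~ is_square (x + in_alg L c).
Proof.
move=> sf; apply/is_squareP => -[y y2].
have size_g : size ('X^2 - c%:P) = 3%N by rewrite size_XnsubC.
have irr_fg := sf ('X^2 - c%:P) (or_intror size_g).
have fgy : root (map_poly (in_alg L) (f \Po ('X^2 - c%:P))) y.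
  rewrite map_comp_poly /root horner_comp rmorphB /= map_polyXn map_polyC /=.
  by rewrite hornerD hornerXn hornerN hornerC y2 addrK.
have [] := irreducible_root_degree irr_fg fgy.
rewrite size_comp_poly_gt1 -?size_poly_eq0 ?size_g ?size_f //= [\dim _]dimL.
by move/(dvdn_leq d_gt0); rewrite leqNgt ltn_Pmulr.
Qed.

(** For a root [y] of [p], [g(y)] is a root of [f] in [F(y)], so [d] divides the degree of [p]. Only
    degree [d] with [g] quadratic must be excluded: completing the square would make a translate of
    [g(y)], and so of its conjugate [x], a square. *)
Lemma size_irreducible_factor_comp (g p : {poly F}) :
    (forall c, ~~ is_square (x + in_alg L c)) ->
    size g = 2%N \/ size g = 3%N -> irreducible_poly p -> p %| f \Po g ->
  size p = size (f \Po g).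
Proof.
move=> nsq size_g irr_p p_fg; have f0 : f != 0 by rewrite -size_poly_eq0 size_f.
have g_gt1 : (1 < size g)%N by case: size_g => ->.
have size_fg := size_comp_poly_gt1 f0 g_gt1; rewrite size_f /= in size_fg.
have fg0 : f \Po g != 0 by rewrite -size_poly_eq0 size_fg.
have [M dimM [y py _]] := irredp_FAdjoin irr_p.
pose z := (map_poly (in_alg M) g).[y].
have fz : root (map_poly (in_alg M) f) z.
  have : root (map_poly (in_alg M) (f \Po g)) y.
    by move: py; apply: root_dvdp; rewrite dvdp_map.
  by rewrite map_comp_poly /root horner_comp.
have [] := irreducible_root_degree irr_f fz; rewrite size_f dimM /= => dvd_d _.
have [p_gt1 _] := irr_p; have le_p := dvdp_leq fg0 p_fg; rewrite size_fg in le_p *.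
have [t def_t] := dvdnP dvd_d.
have def_p : size p = (t * d).+1 by rewrite -def_t prednK // ltnW.
rewrite def_p ltnS mulnC leq_pmul2l // in le_p.
have t_gt0 : (0 < t)%N by move: p_gt1; rewrite def_p; case: t {def_t le_p def_p}.
rewrite def_p mulnC; case: size_g => size_g; rewrite size_g /= in le_p *.
  by congr (_ * _).+1; lia.
have [t1|t_neq1] := eqVneq t 1%N; last by congr (_ * _).+1; lia.
have dimMd : \dim {:M} = d by rewrite dimM def_t t1 mul1n.
exfalso.
pose a := g`_2; pose k := g`_1 / (2%:R * a); pose c := g`_0 - a * k ^+ 2.
have a0 : a != 0 by rewrite /a -[2%N]/(3.-1) -size_g -lead_coefE lead_coef_eq0 -size_poly_gt0 size_g.
have g1 : g`_1 = 2%:R * a * k by rewrite /k mulrCA divff ?mulr1 // mulf_neq0 ?two_neq0.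
have def_z : z - in_alg M c = in_alg M a * (y + in_alg M k) ^+ 2.
  have -> : z = in_alg M g`_0 + in_alg M g`_1 * y + in_alg M a * y ^+ 2.
    rewrite /z horner_coef size_map_poly size_g !big_ord_recr big_ord0 /= !coef_map.
    by rewrite add0r expr0 mulr1 expr1.
  rewrite g1 /c !(rmorphB, rmorphM, rmorphXn, rmorph_nat) /=; ring.
(* A zero square would put the root [z] of [f] in [F], but [d] is at least 2. *)
have [yk0|yk0] := eqVneq (y + in_alg M k) 0.
  have : f %| 'X - c%:P.
    apply: (irreducible_dvdp_root irr_f fz).
    by rewrite rmorphB /= map_polyX map_polyC root_XsubC -subr_eq0 def_z yk0 expr0n mulr0.
  move/dvdp_leq; rewrite polyXsubC_eq0 size_XsubC size_f => /(_ isT).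
  by move: d_gt0 d_even; lia.
(* Euler's criterion becomes a polynomial condition over [F], hence passes from the root [z] in [M]
   to the root [x] in [L]. *)
pose q := ('X - c%:P) ^+ (#|F| ^ d)./2 - 1.
have root_q (K : fieldExtType F) (w : K) :
    root (map_poly (in_alg K) q) w = ((w - in_alg K c) ^+ (#|F| ^ d)./2 == 1).
  rewrite /q rmorphB rmorphXn rmorphB rmorph1 /= map_polyX map_polyC /root.
  by rewrite hornerD hornerN horner_exp hornerXsubC hornerC subr_eq0.
have f_q : f %| q.
  apply: (irreducible_dvdp_root irr_f fz); rewrite root_q def_z exprMn.
  rewrite in_alg_half_power // mul1r -exprM mul2n.
  have := expf_card_pred (odd_card_finvect_type M oddF) yk0.
  by rewrite card_finvect_type dimMd => ->.
have : root (map_poly (in_alg L) q) x by move: fx0; apply: root_dvdp; rewrite dvdp_map.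
have oddL := odd_card_finvect_type fT oddF.
have cardL : #|L| = (#|F| ^ d)%N by rewrite card_finvect_type dimL.
rewrite root_q -cardL => xc1.
have xc0 : x - in_alg L c != 0.
  apply: contraTneq xc1 => ->; rewrite expr0n gtn_eqF ?half_card_gt0 //.
  by rewrite eq_sym oner_eq0.
by have := nsq (- c); rewrite rmorphN Euler_criterion ?xc1.
Qed.

(** Any irreducible factor of a nonconstant divisor [u] already has the full degree of [f \Po g]. *)
Lemma nonsquare_superirreducible2 :
  (forall c, ~~ is_square (x + in_alg L c)) -> superirreducible2 f.
Proof.
move=> nsq g size_g; have f0 : f != 0 by rewrite -size_poly_eq0 size_f.
have g_gt1 : (1 < size g)%N by case: size_g => ->.
have size_fg := size_comp_poly_gt1 f0 g_gt1; rewrite size_f /= in size_fg.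
have fg0 : f \Po g != 0 by rewrite -size_poly_eq0 size_fg.
split=> [|u u_neq1 u_fg].
  by rewrite size_fg ltnS muln_gt0 d_gt0; case: size_g => ->.
have u0 : u != 0 by apply: contraNneq fg0 => e; rewrite e dvd0p in u_fg.
have u_gt1 : (1 < size u)%N by rewrite ltn_neqAle eq_sym u_neq1 size_poly_gt0.
have [p irr_p p_u] := irreducible_factor u_gt1.
rewrite -dvdp_size_eqp // eqn_leq dvdp_leq //=.
rewrite -(size_irreducible_factor_comp nsq size_g irr_p) ?(dvdp_trans p_u) //.
exact: dvdp_leq.
Qed.

End Root.

End Superirreducible.

(** * Counting *)

Lemma superirreducible2_irreducible (F : fieldType) (f : {poly F}) :
  superirreducible2 f -> irreducible_poly f.
Proof.
move=> sf; rewrite -[f]comp_polyXr; apply: sf.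
by left; rewrite size_polyX.
Qed.

Lemma card_expf_fixed_le (L : finFieldType) (n : nat) : (1 < n)%N ->
  (#|[set x : L | x ^+ n == x]| <= n)%N.
Proof.
move=> n_gt1; have size_p : size ('X^n - 'X : {poly L}) = n.+1.
  by rewrite size_polyDl size_polyXn // size_polyN size_polyX.
rewrite -ltnS -size_p cardE; apply: max_poly_roots; last exact: enum_uniq.
  by rewrite -size_poly_eq0 size_p.
apply/allP => x; rewrite mem_enum inE => /eqP xn.
by rewrite rootE hornerD hornerN hornerXn hornerX xn subrr.
Qed.

(** The ratio is at least 9, and [9 / 8 = 1 / (1 - 1 / 9)]. *)
Lemma geometric_sum_lt (q r : nat) : (2 < q)%N ->
  (8 * \sum_(j < r) q ^ (j.+1).*2 < 9 * q ^ r.*2)%N.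
Proof.
move=> q_gt2; elim: r => [|r IHr]; first by rewrite big_ord0.
rewrite big_ord_recr /= doubleS !expnS; move: IHr; move: (\sum_(_ < _) _)%N => A.
move: (q ^ r.*2)%N => B.
have : (9 * B <= q * (q * B))%N by rewrite mulnA leq_mul // (leq_mul q_gt2 q_gt2).
lia.
Qed.

Section Counting.

Variables (F : finFieldType) (d : nat) (fT : fieldExtType F).
Hypotheses (oddF : odd #|F|) (d_gt0 : (0 < d)%N) (d_even : ~~ odd d).
Hypothesis dimL : \dim {:fT} = d.

Local Notation L := (finvect_type fT).
Local Notation "f ^L" := (map_poly (in_alg L) f) (at level 2, format "f ^L").

Let cardL : #|L| = (#|F| ^ d)%N.
Proof. by rewrite card_finvect_type dimL. Qed.

(** [f] divides [X^#|L| - X], which splits over [L] into distinct linear factors. *)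
Lemma card_irreducible_roots (f : {poly F}) :
  irreducible_poly f -> size f = d.+1 -> #|[set x : L | root f^L x]| = d.
Proof.
move=> irr_f size_f; have [K dimK [z fz _]] := irredp_FAdjoin irr_f.
have [_ zq] := irreducible_root_degree irr_f fz.
have : f %| 'X^(#|L|) - 'X.
  apply: (irreducible_dvdp_root irr_f fz).
  rewrite rmorphB /= map_polyXn map_polyX /root hornerD hornerN hornerXn hornerX.
  by rewrite cardL; rewrite size_f in zq; rewrite zq subrr.
rewrite -(dvdp_map (in_alg L)) rmorphB /= map_polyXn map_polyX finField_genPoly -big_enum.
case/dvdp_prod_XsubC => m def_f.
have := eqp_size def_f; rewrite size_map_poly size_f size_prod_XsubC => -[->].
rewrite -(card_uniqP _) ?mask_uniq ?enum_uniq //; apply: eq_card => x.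
by rewrite inE (eqp_root def_f) root_prod_XsubC.
Qed.

Local Notation N := (nonsquare_translates (in_alg L : F -> L)).
Local Notation S2 := [set f : {poly_(d.+1) F} |
      [&& size (f : {poly F}) == d.+1, (f : {poly F}) \is monic
        & `[< superirreducible2 (f : {poly F}) >]]].

(** These are the elements of [N] of degree less than [d] over [F], described so that they
    complement the roots of the polynomials in [S2]. *)
Definition low_degree_nonsquares : {set L} :=
  [set x in N | [forall f in S2, ~~ root (polyn f)^L x]].

Lemma root_superirreducible2 (f : {poly_(d.+1) F}) (x : L) :
  f \in S2 -> root (polyn f)^L x -> x \in N.
Proof.
rewrite inE => /and3P[/eqP size_f _ /asboolP sf] fx0.
by rewrite inE; apply/forallP => c; apply: (superirreducible2_nonsquare d_gt0 dimL size_f fx0).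
Qed.

(** Count the pairs of [f] in [S2] and a root of [f] in two ways: each [f] has [d] roots, and each
    root determines its monic irreducible [f]. *)
Lemma card_nonsquare_translates_s2 : #|N| = (d * s2 F d + #|low_degree_nonsquares|)%N.
Proof.
rewrite -(cardsID low_degree_nonsquares N) addnC (setIidPr _); last first.
  by apply/subsetP => x; rewrite inE => /andP[].
congr (_ + _)%N; set A := _ :\: _.
have A_root x : x \in A -> #|[set f in S2 | root (polyn f)^L x]| = 1%N.
  rewrite !inE => /andP[+ Nx]; rewrite Nx /= negb_forall => /existsP[f].
  rewrite negb_imply negbK => /andP[Sf fx0]; apply/eqP/cards1P; exists f.
  apply/setP => g; rewrite inE in_set1; apply/andP/eqP => [[Sg gx0]|->//].
  move: Sf Sg; rewrite !inE => /and3P[_ f_monic /asboolP/superirreducible2_irreducible irr_f].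
  case/and3P => _ g_monic /asboolP/superirreducible2_irreducible irr_g.
  apply/val_inj/eqP; rewrite -eqp_monic //.
  by rewrite /eqp (irreducible_dvdp_root irr_f fx0) // (irreducible_dvdp_root irr_g gx0).
rewrite /s2 mulnC -sum_nat_const -sum1_card.
transitivity (\sum_(x in A) \sum_(f in S2 | root (polyn f)^L x) 1)%N.
  by apply: eq_bigr => x Ax; rewrite sum1dep_card A_root.
rewrite (exchange_big_dep (mem S2)) /=; last by move=> x f _ /andP[].
apply: eq_bigr => f Sf; rewrite sum1dep_card -[RHS](card_irreducible_roots (f := polyn f)).
- apply: eq_card => x; rewrite 2!in_set Sf /=.
  apply/andP/idP => [[_ //]|fx0]; split=> //.
  rewrite in_setD (root_superirreducible2 Sf fx0) andbT in_set negb_and negb_forall.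
  by apply/orP; right; apply/existsP; exists f; rewrite negb_imply Sf negbK.
- by move: Sf; rewrite inE => /and3P[_ _ /asboolP/superirreducible2_irreducible].
by move: Sf; rewrite inE => /and3P[/eqP].
Qed.

(** The degree [e] of [x] is a proper divisor of [d] with odd quotient, so the quotient is at least
    3 and [e] is even; take [e = 2 (j + 1)]. *)
Lemma low_degree_fixed (x : L) : x \in low_degree_nonsquares ->
  exists j : 'I_(d./2 %/ 3), x ^+ (#|F| ^ (j.+1).*2) == x.
Proof.
rewrite inE => /andP[Nx /forall_inP no_root]; move: (Nx); rewrite inE => /forallP nsq.
have [p [p_monic irr_p px0 + x_fixed]] := minimal_polynomial x.
rewrite [\dim _]dimL; set e := (size p).-1 => dvd_e.
have size_p : size p = e.+1 by rewrite prednK //; case: irr_p => /ltnW.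
have e_neq : e != d.
  apply/eqP => e_d; rewrite e_d in size_p.
  have le_p : (size p <= d.+1)%N by rewrite size_p.
  have /no_root : NPoly (le_p : p \is a poly_of_size d.+1) \in S2.
    rewrite inE /= size_p eqxx p_monic; apply/asboolP.
    exact: (nonsquare_superirreducible2 oddF d_gt0 d_even dimL irr_p size_p px0 nsq).
  by rewrite px0.
have x0 : x != 0.
  by apply: contraNneq (nsq 0) => ->; rewrite rmorph0 addr0 is_square0.
(* Otherwise [x] would be a square in [L], against the translate by 0. *)
have ndvd : ~~ (e.*2 %| d)%N.
  apply/negP => dvd_2e; have := nsq 0; rewrite rmorph0 addr0 Euler_criterion //; last first.
    exact: odd_card_finvect_type.
  rewrite cardL; have /dvdnP[t ->] := dvdn_half_expn_double oddF dvd_2e d_gt0.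
  rewrite mulnC exprM; have -> : x ^+ (#|F| ^ e).-1 = 1.
    apply: (mulfI x0); rewrite -exprS mulr1 prednK // expn_gt0.
    by rewrite (leq_trans _ (finNzRing_gt1 F)).
  by rewrite expr1n eqxx.
have [o def_d] := dvdnP dvd_e.
have odd_o : odd o.
  apply: contraR ndvd => even_o; apply/dvdnP; exists o./2.
  by rewrite def_d -[in LHS](odd_double_half o) (negbTE even_o); lia.
have o_gt1 : o != 1%N by apply: contraNneq e_neq => o1; rewrite def_d o1 mul1n.
have even_e : ~~ odd e by move: d_even; rewrite def_d oddM odd_o.
have [j e2] : exists j, e = j.*2.
  by exists e./2; rewrite -[LHS]odd_double_half (negbTE even_e).
have j_gt0 : (0 < j)%N by move: d_gt0; rewrite def_d e2; case: j {e2}; rewrite ?muln0.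
have lt_j : (j.-1 < d./2 %/ 3)%N.
  rewrite prednK // leq_divRL // def_d e2 -doubleMr doubleK mulnC leq_mul2r.
  by apply/orP; right; move: o odd_o o_gt1 {def_d} => [|[|[|o]]].
by exists (Ordinal lt_j); rewrite //= prednK // -e2 x_fixed.
Qed.

Lemma card_low_degree_nonsquares_lt :
  (8 * #|low_degree_nonsquares| < 3 * #|F| ^ d./2)%N.
Proof.
have F_gt2 : (2 < #|F|)%N by have : (1 < #|F|)%N := finNzRing_gt1 F; move: oddF; case: #|F| => [|[|[]]].
have le_low : (#|low_degree_nonsquares| <=
    \sum_(j < d./2 %/ 3) #|F| ^ (j.+1).*2)%N.
  apply: (@leq_trans (\sum_(j < d./2 %/ 3) #|[set x : L | x ^+ (#|F| ^ (j.+1).*2) == x]|)%N).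
    have -> : (\sum_(j < d./2 %/ 3) #|[set x : L | x ^+ (#|F| ^ (j.+1).*2) == x]| =
        \sum_(x : L) \sum_(j < d./2 %/ 3 | x ^+ (#|F| ^ (j.+1).*2) == x) 1)%N.
      rewrite (exchange_big_dep predT) //=; apply: eq_bigr => j _.
      by rewrite sum1dep_card.
    rewrite -sum1_card big_mkcond /=; apply: leq_sum => x _.
    case: ifP => // /low_degree_fixed[j jx].
    by rewrite (bigD1 j).
  apply: leq_sum => j _; apply: card_expf_fixed_le.
  by rewrite -[X in (X < _)%N](exp1n (j.+1).*2) ltn_exp2r // ltnW.
have := geometric_sum_lt (d./2 %/ 3) F_gt2.
have h_gt0 : (0 < d./2)%N by move: d_gt0 d_even; case: d => [|[|]].
(* For [r = d./2 %/ 3], [3 r <= d./2] and [d./2 > 0] give [2 r + 1 <= d./2]; the extra factor [#|F|]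
   is at least 3. *)
have : (3 * #|F| ^ (d./2 %/ 3).*2 <= #|F| ^ d./2)%N.
  apply: (@leq_trans (#|F| ^ (d./2 %/ 3).*2.+1)%N); first by rewrite expnS leq_mul2r F_gt2 orbT.
  by rewrite leq_pexp2l ?(ltnW (ltnW F_gt2)) //; lia.
move: le_low; move: (\sum_(_ < _) _)%N => A; lia.
Qed.

End Counting.

(** * Degree two and the final estimate *)

(* Writing [f = (t + b)^2 - 4w - 1], the substitution
   [g = -2 t^2 + 2w + 1 - b] gives [f(g) = 4 ((t^2 - w)^2 - t^2)]. *)
Lemma monic_quadratic_not_superirreducible2 (F : fieldType) (f : {poly F}) :
  2%:R != 0 :> F -> f \is monic -> size f = 3%N -> ~ superirreducible2 f.
Proof.
move=> F2 f_monic size_f sf.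
pose b := f`_1 / 2%:R; pose w := (b ^+ 2 - f`_0 - 1) / (2%:R * 2%:R).
have f1 : f`_1 = 2%:R * b by rewrite /b mulrC divfK.
have f0 : f`_0 = b ^+ 2 - 2%:R * 2%:R * w - 1.
  by rewrite /w [_ * (_ / _)]mulrC divfK ?mulf_neq0 //; ring.
have f2 : f`_2 = 1 by move/monicP: f_monic; rewrite lead_coefE size_f.
have def_f : f = 'X^2 + (2%:R * b)%:P * 'X + (b ^+ 2 - 2%:R * 2%:R * w - 1)%:P.
  rewrite -[LHS]coefK size_f poly_def !big_ord_recr big_ord0 /= f0 f1 f2.
  by rewrite scale1r expr0 expr1 -mul_polyC mulr1 -!mul_polyC; ring.
pose u : {poly F} := 'X^2 + ('X - w%:P).
pose g : {poly F} := - 2%:R *: 'X^2 + (2%:R * w + 1 - b)%:P.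
have size_g : size g = 3%N.
  have gc : (size ((2%:R * w + 1 - b)%:P : {poly F}) < 3)%N.
    by rewrite (leq_ltn_trans (size_polyC_leq1 _)).
  by rewrite /g size_polyDl size_scale ?oppr_eq0 // size_polyXn.
have size_u : size u = 3%N by rewrite /u size_polyDl size_polyXn // size_XsubC.
have [_ irr_fg] := sf g (or_intror size_g).
have u_fg : u %| f \Po g.
  apply/dvdpP; exists (2%:R * 2%:R * ('X^2 - 'X - w%:P)).
  rewrite def_f !(comp_polyD, comp_polyM, comp_polyC, comp_polyX, comp_Xn_poly).
  rewrite /g /u -mul_polyC !(rmorphB, rmorphD, rmorphM, rmorphXn, rmorphN, rmorph_nat, rmorph1) /=.
  by ring.
have := eqp_size (irr_fg u _ u_fg); rewrite size_u.
rewrite size_comp_poly_gt1 ?size_g -?size_poly_eq0 ?size_f //=.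
by move/(_ isT).
Qed.

Lemma s2_2 (F : finFieldType) : odd #|F| -> s2 F 2 = 0%N.
Proof.
move=> oddF; apply/eqP; rewrite /s2 cards_eq0; apply/eqP/setP => f; rewrite !inE.
apply/negP => /and3P[/eqP size_f f_monic /asboolP].
exact: monic_quadratic_not_superirreducible2 (two_neq0 oddF) f_monic size_f.
Qed.

Lemma s2_estimate (F : finFieldType) (m : nat) : odd #|F| -> (1 < m)%N ->
  `|(2 ^ #|F| * (m.*2 * s2 F m.*2))%:R - (#|F| ^ m.*2)%:R : int| * 2 <
    (2 ^ #|F| * #|F| * #|F| ^ m)%:R.
Proof.
move=> oddF m_gt1; have d_gt0 : (0 < m.*2)%N by rewrite double_gt0 ltnW.
have d_even : ~~ odd m.*2 by rewrite odd_double.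
have [fT dimL] := exists_finite_extension F d_gt0.
have F_gt2 : (2 < #|F|)%N.
  by have : (1 < #|F|)%N := finNzRing_gt1 F; move: oddF; case: #|F| => [|[|[]]].
have card_L : #|finvect_type fT| = ((#|F| ^ m) ^ 2)%N.
  by rewrite card_finvect_type dimL -expnM muln2.
have s_odd : odd (#|F| ^ m) by rewrite oddX oddF orbT.
(* Here [m] at least 2 is essential: [(q + 1) / 2 < q] gives only a bound by [q ^ 2]. *)
have lt_s : (uphalf #|F| ^ 2 < #|F| ^ m)%N.
  apply: (@leq_trans (#|F| ^ 2)%N); last by rewrite leq_pexp2l // ltnW // ltnW.
  by rewrite ltn_sqr; move: F_gt2; move: #|F| => q; lia.
have sq_diff (c : F) : exists2 c', in_alg (finvect_type fT) c' != in_alg (finvect_type fT) c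
    & is_square (in_alg (finvect_type fT) c' - in_alg (finvect_type fT) c).
  exists (c + 1); first by rewrite fmorph_eq -subr_eq0 addrAC subrr add0r oner_eq0.
  rewrite -rmorphB addrAC subrr add0r rmorph1; apply/is_squareP.
  by exists 1; rewrite expr1n.
have := card_nonsquare_translates card_L s_odd (fmorph_inj (in_alg (finvect_type fT))) oddF lt_s sq_diff.
rewrite (card_nonsquare_translates_s2 d_gt0 dimL).
have := card_low_degree_nonsquares_lt oddF d_gt0 d_even dimL.
rewrite doubleK -expnM muln2 mulnDr.
have : (8 <= 2 ^ #|F|)%N by rewrite -[8%N]/(2 ^ 3)%N leq_pexp2l.
move: #|low_degree_nonsquares _ _| => B; move: (#|F| ^ m)%N F_gt2 => s.
move: (2 ^ #|F|)%N (#|F| ^ m.*2)%N (m.*2 * s2 F m.*2)%N => e Q n.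
move: #|F| => q q_gt2 e_ge8 B_lt.
(* Of the saving [e * s], the low-degree elements cost [2 * e * B < (3 / 4) * e * s] and the term
   [2 * s] at most [e * s / 4], as [e >= 8]. *)
have eB_lt : (8 * (e * B) < 3 * (e * s))%N.
  by rewrite mulnCA [ltnRHS]mulnCA ltn_pmul2l // (leq_trans _ e_ge8).
have es_ge : (8 * s <= e * s)%N by rewrite leq_mul2r e_ge8 orbT.
have -> : (s * (e * q.-1 + 2) = e * q * s - e * s + 2 * s)%N.
  by case: q q_gt2 => // q _; rewrite /= mulnSr mulnDl addnK; lia.
have eqs_ge : (e * s <= e * q * s)%N by rewrite leq_mul2r leq_pmulr ?orbT // ltnW // ltnW.
move: (e * B)%N (e * s)%N (e * q * s)%N (e * n)%N eB_lt es_ge eqs_ge => x y z t.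
by lia.
Qed.

Theorem theorem3p4 (F : finFieldType) (q d : nat)
    (hq : #|F| = q) (q_odd : odd q) (d_gt0 : (0 < d)%N) (d_even : ~~ odd d) :
  `| (s2 F d)%:R - q%:R ^+ d / (d%:R * 2%:R ^+ q) |
    < q%:R / (2%:R * d%:R) * q%:R ^+ (d./2) :> rat.
Proof.
move: q_odd d_gt0; rewrite -hq => oddF.
rewrite -[d]odd_double_half (negbTE d_even) add0n doubleK.
set m := d./2 => m_gt0.
have q_gt0 : 0 < #|F|%:R :> rat by rewrite ltr0n ltnW ?finNzRing_gt1.
have d_pos : 0 < (m.*2)%:R :> rat by rewrite ltr0n.
have E_pos : 0 < 2%:R ^+ #|F| :> rat by rewrite exprn_gt0.
(* For [d = 2] the count is 0 and the claim reduces to [2 < 2 ^ q]. *)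
have [m1|m_neq1] := eqVneq m 1%N.
  rewrite m1 s2_2 //.
  have E_gt2 : 2%:R < 2%:R ^+ #|F| :> rat.
    by rewrite -natrX ltr_nat -[X in (X < _)%N](expn1 2) ltn_exp2l ?finNzRing_gt1.
  rewrite sub0r normrN ger0_norm; last first.
    by rewrite divr_ge0 ?exprn_ge0 ?mulr_ge0 // ltW.
  rewrite expr1 expr2 [ltRHS]mulrAC ltr_pM2l ?mulr_gt0 //.
  rewrite ltf_pV2 ?posrE ?mulr_gt0 // [ltRHS]mulrC ltr_pM2r //.
have m_gt1 : (1 < m)%N by rewrite ltn_neqAle eq_sym m_neq1 -double_gt0.
have := s2_estimate oddF m_gt1; rewrite -(ltr_int rat).
rewrite intrM intr_norm intrB !natz -!pmulrn !natrM !natrX => lt_est.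
have K_pos : 0 < (m.*2)%:R * 2%:R ^+ #|F| * 2%:R :> rat by rewrite !mulr_gt0.
rewrite -(ltr_pM2r K_pos) -[X in _ * X](gtr0_norm K_pos) -normrM.
have d0 := lt0r_neq0 d_pos; have E0 := lt0r_neq0 E_pos.
move: lt_est; rewrite -[X in _ * X < _](ger0_norm (ler0n rat 2)) -normrM.
congr (`|_| < _); first by field; rewrite d0 E0.
by field; rewrite d0.
Qed.
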